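(* Let $\mathcal{A}$ and $\mathcal{B}$ be uniform algebras (on compact Hausdorff spaces) and $T$ a group homomorphism from $\mathcal{A}^{-1}$ onto $\mathcal{B}^{-1}$ such that $$\sigma_{\pi}(Tf)\subset\sigma_{\pi}(f)$$ holds for every $f\in\mathcal{A}^{-1}$. Then $T$ is extended to an isometrical algebra isomorphism from $\mathcal{A}$ onto $\mathcal{B}$.
   Context: A uniform algebra on a compact Hausdorff space $X$ is a uniformly closed subalgebra of $C(X)$ (complex-valued continuous functions) which contains the constants and separates the points of $X$. $A^{-1}$ denotes the group of invertible elements of $A$. The peripheral spectrum of $f$ is $\sigma_{\pi}(f)=\{z\in\sigma(f):|z|=\mathrm{r}(f)\}$, where $\sigma(f)$ is the spectrum and $\mathrm{r}(f)$ the spectral radius. *)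

(* Defs.v *)
From mathcomp Require Import all_boot all_order all_algebra.
From mathcomp Require Import all_classical all_reals all_analysis.
From mathcomp.real_closed Require Export complex.

Set Implicit Arguments.
Unset Strict Implicit.
Unset Printing Implicit Defensive.

Import Order.TTheory GRing.Theory Num.Theory.
Import numFieldNormedType.Exports.

Local Open Scope classical_set_scope.
Local Open Scope ring_scope.

(* [R[i]] itself carries no topology in the library; its alias [R[i]^o] does
   (as a normed module over [R[i]]), hence [R[i]^o] as the type of values. *)

(* Real-valued modulus: the generic norm [`|z|] of [z : R[i]] lives in [R[i]]. *)
Definition cmod (R : realType) (z : R[i]) : R := ComplexField.Normc.normc z.

Definition sup_norm (R : realType) (X : Type) (f : X -> R[i]^o) : R :=
  sup [set cmod (f x) | x in [set: X]].

Record uniform_algebra (R : realType) (X : topologicalType)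
    (A : set (X -> R[i]^o)) : Prop := {
  ua_continuous : forall f, A f -> continuous f;
  ua_cst : forall z : R[i], A (cst z);
  ua_add : forall f g, A f -> A g -> A (f + g);
  ua_scale : forall (z : R[i]) f, A f -> A (z *: f);
  ua_mul : forall f g, A f -> A g -> A (f * g);
  ua_closed : closed (A : set {uniform X -> R[i]^o});
  ua_separates : forall x y : X, x <> y -> exists2 f, A f & f x <> f y
}.

Definition invertibles (R : realType) (X : Type) (A : set (X -> R[i]^o)) :
    set (X -> R[i]^o) :=
  [set f | A f /\ exists2 g, A g & f * g = 1].

Definition spectrum (R : realType) (X : Type) (A : set (X -> R[i]^o))
    (f : X -> R[i]^o) : set R[i] :=
  [set z | ~ invertibles A (f - cst z)].

Definition spectral_radius (R : realType) (X : Type) (A : set (X -> R[i]^o))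
    (f : X -> R[i]^o) : R :=
  sup [set cmod z | z in spectrum A f].

Definition peripheral_spectrum (R : realType) (X : Type)
    (A : set (X -> R[i]^o)) (f : X -> R[i]^o) : set R[i] :=
  [set z | spectrum A f z /\ cmod z = spectral_radius A f].

Definition group_hom_onto (R : realType) (X Y : Type)
    (A : set (X -> R[i]^o)) (B : set (Y -> R[i]^o))
    (T : (X -> R[i]^o) -> (Y -> R[i]^o)) : Prop :=
  [/\ set_fun (invertibles A) (invertibles B) T,
      forall f g, invertibles A f -> invertibles A g ->
        T (f * g) = T f * T g
    & set_surj (invertibles A) (invertibles B) T].

Record isometric_algebra_isomorphism (R : realType) (X Y : Type)
    (A : set (X -> R[i]^o)) (B : set (Y -> R[i]^o))
    (S : (X -> R[i]^o) -> (Y -> R[i]^o)) : Prop := {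
  iai_bij : set_bij A B S;
  iai_add : forall f g, A f -> A g -> S (f + g) = S f + S g;
  iai_scale : forall (z : R[i]) f, A f -> S (z *: f) = z *: S f;
  iai_mul : forall f g, A f -> A g -> S (f * g) = S f * S g;
  iai_isometry : forall f g, A f -> A g ->
    sup_norm (S f - S g) = sup_norm (f - g)
}.

(* Main.v *)
Require Import Defs.
From mathcomp Require Import all_boot all_order all_algebra.
From mathcomp Require Import all_classical all_reals all_analysis.
From mathcomp.real_closed Require Import complex.
From mathcomp Require Import ring lra.

Set Implicit Arguments.
Unset Strict Implicit.
Unset Printing Implicit Defensive.

Import Order.TTheory GRing.Theory Num.Theory.
Import numFieldNormedType.Exports.

Local Open Scope classical_set_scope.
Local Open Scope ring_scope.

(** The spectral part is classical: for [f] in a uniform algebra the spectrum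
    lies in the disc of radius the sup norm, and a spectral value on the
    bounding circle is actually a value of [f] ([peripheralP]).  So the
    hypothesis says that [T] preserves sup norms, and that every value of [T f]
    of largest modulus is also a value of [f] of largest modulus.  In
    particular [T] fixes the nonzero constants ([hom_cst]).

    The main point is that [T] is additive wherever this makes sense ([homD]):
    if [f1], [f2] and [f1 + f2] are invertible, then
    [T (f1 + f2) = T f1 + T f2].  One would like to compare [T f] at a
    boundary point of [Y] with [f] at a corresponding boundary point of [X].
    Peak sets replace the points.  A function [q] is peaking when it is
    invertible, has norm 1, and takes the value 1 wherever its modulus is 1; its
    peak set is [{q = 1}].  Two facts about peak sets are needed.
    - Bishop's lemma ([bishop_peak]): for [f] invertible, [q] can be replaced
      by a peaking function [q'] equal to 1 on [{q = 1}] and so small elsewhere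
      that the modulus of [q' f] exceeds nowhere, and off [{q = 1}] does not
      even reach, the maximum of the modulus of [f] over [{q = 1}].
    - Every peak set contains a peak set on which a given element of the
      algebra is constant ([constant_peak]).

    Now let [T g] be peaking, [q] peaking with [g] of modulus 1 on [{q = 1}],
    and [f] invertible with constant value [z] on [{q = 1}].  Applying norm
    preservation to the products of [f] with powers of [g] and of Bishop's [q']
    produces a point of [{T g = 1}] where [T f] equals [z]
    ([peak_value_transport]).  Suppose that additivity failed for [f1], [f2].
    In the set where [T (f1 + f2) - T f1 - T f2] equals a nonzero value of
    largest modulus there is a peak set on which [T f1], [T f2] and
    [T (f1 + f2)] are constant; its peaking function is [T g] for some [g] by
    surjectivity.  In the set where [g] equals a value of largest modulus there
    is a peak set on which [f1] and [f2] are constant.  By transport the three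
    constants in [Y] are those in [X], and the last is the sum of the first two:
    a contradiction.

    Finally every [f] in [A] is the difference of the invertible [f + c] and a
    large constant [c], and [S f = T (f + c) - c] is independent of [c] by
    additivity.  Additivity, multiplicativity and isometry of [S] are read off
    from [T] by taking [c] large enough. *)

(** * Complex modulus *)

Section Modulus.
Context {R : realType}.
Implicit Types z w : R[i].

Lemma normE z : `|z| = (cmod z)%:C%C.
Proof. by []. Qed.

Lemma cmod_ge0 z : 0 <= cmod z.
Proof. by case: z => a b; exact: sqrtr_ge0. Qed.

Lemma cmod0 : cmod (0 : R[i]) = 0.
Proof. exact: ComplexField.Normc.normc0. Qed.

Lemma cmod1 : cmod (1 : R[i]) = 1.
Proof. exact: ComplexField.Normc.normc1. Qed.

Lemma cmodM z w : cmod (z * w) = cmod z * cmod w.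
Proof. exact: ComplexField.Normc.normcM. Qed.

Lemma cmodV z : cmod z^-1 = (cmod z)^-1.
Proof. exact: ComplexField.Normc.normcV. Qed.

Lemma cmodX z n : cmod (z ^+ n) = cmod z ^+ n.
Proof. by elim: n => [|n IH]; rewrite ?expr0 ?cmod1// !exprS cmodM IH. Qed.

Lemma cmodN z : cmod (- z) = cmod z.
Proof. exact: normcN. Qed.

Lemma cmodD z w : cmod (z + w) <= cmod z + cmod w.
Proof. exact: le_normcD. Qed.

Lemma cmodB z w : cmod (z - w) <= cmod z + cmod w.
Proof. by rewrite -[in leRHS](cmodN w); exact: cmodD. Qed.

Lemma cmodBC z w : cmod (z - w) = cmod (w - z).
Proof. by rewrite -cmodN opprB. Qed.

Lemma cmod_lB z w : cmod z - cmod w <= cmod (z - w).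
Proof. by rewrite lerBlDr (le_trans _ (cmodD _ _))// subrK. Qed.

Lemma cmod_eq0 z : (cmod z == 0) = (z == 0).
Proof.
apply/eqP/eqP => [|->]; last exact: cmod0.
exact: ComplexField.Normc.eq0_normc.
Qed.

Lemma cmod_gt0 z : (0 < cmod z) = (z != 0).
Proof. by rewrite lt0r cmod_eq0 cmod_ge0 andbT. Qed.

Lemma cmod_real (a : R) : 0 <= a -> cmod a%:C%C = a.
Proof. by move=> a0; rewrite /cmod /= expr0n addr0 sqrtr_sqr ger0_norm. Qed.

Lemma cmod_Re z : `|complex.Re z| <= cmod z.
Proof. by rewrite -lecR; exact: normc_ge_Re. Qed.

Lemma cmod_le_ReIm z : cmod z <= `|complex.Re z| + `|complex.Im z|.
Proof.
case: z => a b /=; rewrite -ler_sqr ?nnegrE ?addr_ge0 ?sqrtr_ge0//.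
rewrite /cmod /= sqr_sqrtr ?addr_ge0 ?sqr_ge0// sqrrD !real_normK ?num_real//.
by have := mulr_ge0 (normr_ge0 a) (normr_ge0 b); lra.
Qed.

Lemma cmod_Im z : `|complex.Im z| <= cmod z.
Proof.
case: z => a b /=; rewrite -ler_sqr ?nnegrE ?sqrtr_ge0//.
rewrite /cmod /= sqr_sqrtr ?addr_ge0 ?sqr_ge0// real_normK ?num_real//.
by rewrite lerDr sqr_ge0.
Qed.

(** Strict convexity of the disc.  It is what makes translates of a function
    peak: among the points [w] of the disc of radius [cmod z], only [z] itself
    is farthest from [- s z]. *)
Lemma cmodDZ_eq z w (s : R) : 0 < s -> cmod w <= cmod z ->
  cmod (w + s%:C%C * z) = (1 + s) * cmod z -> w = z.
Proof.
case: z w => [a b] [c d] s0.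
have -> : (c +i* d)%C + s%:C%C * (a +i* b)%C =
    ((c + s * a) +i* (d + s * b))%C.
  by apply/eqP; rewrite eq_complex /=; apply/andP; split; apply/eqP; ring.
move=> wz e.
have {}wz : c ^+ 2 + d ^+ 2 <= a ^+ 2 + b ^+ 2.
  by rewrite -ler_sqrt ?addr_ge0 ?sqr_ge0.
have {}e : (c + s * a) ^+ 2 + (d + s * b) ^+ 2 =
    (1 + s) ^+ 2 * (a ^+ 2 + b ^+ 2).
  have := congr1 (fun t => t ^+ 2) e.
  by rewrite exprMn /cmod /= !sqr_sqrtr ?addr_ge0 ?sqr_ge0.
have h : s * ((c - a) ^+ 2 + (d - b) ^+ 2) <= 0 by nra.
have {}h : (c - a) ^+ 2 + (d - b) ^+ 2 = 0.
  apply/eqP; rewrite eq_le addr_ge0 ?sqr_ge0// andbT.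
  by rewrite -(pmulr_rle0 _ s0).
move/eqP: h; rewrite paddr_eq0 ?sqr_ge0// !sqrf_eq0 !subr_eq0.
by move=> /andP[/eqP-> /eqP->].
Qed.

Lemma le_half_pow (a b c : R) : (forall n, a <= b + c * 2^-1 ^+ n) -> a <= b.
Proof.
move=> h; rewrite leNgt; apply/negP => ba.
have [c0|c0] := lerP c 0.
  have := h 0%N; rewrite expr0 mulr1 => ?; lra.
have : (geometric 1 (2^-1 : R)) @ \oo --> (0 : R).
  by apply: cvg_geometric; rewrite ger0_norm; lra.
move=> /cvgrPdist_lt/(_ ((a - b) / c)); rewrite divr_gt0 ?subr_gt0// => /(_ erefl).
move=> [N _ /(_ N (leqnn N))] /=.
rewrite sub0r normrN mul1r ger0_norm ?exprn_ge0// ltr_pdivlMr// => hN.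
by have := h N; rewrite mulrC; lra.
Qed.

(** The intervals of centre [a n] and radius [2^-1 ^+ n] are nested, so the
    supremum of their left ends lies in all of them. *)
Lemma real_half_cvg (a : nat -> R) :
  (forall n, `|a n.+1 - a n| <= 2^-1 ^+ n.+1) ->
  exists l, forall n, `|l - a n| <= 2^-1 ^+ n.
Proof.
move=> ha; pose v n := 2^-1 ^+ n : R.
have vS n : v n = v n.+1 + v n.+1 by rewrite /v exprS; lra.
have up n m : a (n + m)%N + v (n + m)%N <= a n + v n.
  elim: m => [|m IH]; rewrite ?addn0// addnS.
  have := ha (n + m)%N; rewrite ler_norml => /andP[_]; rewrite -/(v _).
  by move: IH; rewrite (vS (n + m)%N); lra.
have lo n m : a n - v n <= a (n + m)%N - v (n + m)%N.
  elim: m => [|m IH]; rewrite ?addn0// addnS.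
  have := ha (n + m)%N; rewrite ler_norml => /andP[+ _]; rewrite -/(v _).
  by move: IH; rewrite (vS (n + m)%N); lra.
have v0 n : 0 <= v n by rewrite exprn_ge0.
have lu n m : a n - v n <= a m + v m.
  have := lo n m; have := up m n; have := v0 (n + m)%N.
  by rewrite (addnC m n); lra.
pose S := [set a n - v n | n in [set: nat]].
exists (sup S) => n; rewrite ler_norml; apply/andP; split.
  have : a n - v n <= sup S.
    apply: ub_le_sup; last by exists n.
    by exists (a 0%N + v 0%N) => _ [m _ <-].
  by rewrite -/(v n); lra.
have : sup S <= a n + v n.
  by apply: ge_sup; [exists (a 0%N - v 0%N), 0%N|move=> _ [m _ <-]].
by rewrite -/(v n); lra.
Qed.

Lemma complex_half_cvg (u : nat -> R[i]) :
  (forall n, cmod (u n.+1 - u n) <= 2^-1 ^+ n.+1) ->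
  exists l, forall n, cmod (l - u n) <= 2 * 2^-1 ^+ n.
Proof.
move=> hu.
have ReB z w : complex.Re (z - w) = complex.Re z - complex.Re w.
  by case: z w => [? ?] [].
have ImB z w : complex.Im (z - w) = complex.Im z - complex.Im w.
  by case: z w => [? ?] [].
have [a ha] : exists l, forall n, `|l - complex.Re (u n)| <= 2^-1 ^+ n.
  by apply: real_half_cvg => n; rewrite -ReB (le_trans (cmod_Re _)).
have [b hb] : exists l, forall n, `|l - complex.Im (u n)| <= 2^-1 ^+ n.
  by apply: real_half_cvg => n; rewrite -ImB (le_trans (cmod_Im _)).
exists (a +i* b)%C => n; rewrite (le_trans (cmod_le_ReIm _))// ReB ImB /=.
by have := ha n; have := hb n; lra.
Qed.

Lemma geometric_sum w n :
  w != 1 -> \sum_(i < n) w ^+ i = (1 - w ^+ n) / (1 - w).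
Proof.
move=> w1; have d0 : 1 - w != 0 by rewrite subr_eq0 eq_sym.
apply: (mulIf d0); rewrite mulfVK//.
by rewrite -[1 - _ ^+ n]opprB subrX1 -mulNr opprB mulrC.
Qed.

Lemma cmod_nat n : cmod (n%:R : R[i]) = n%:R.
Proof. by rewrite -[n%:R in LHS](rmorph_nat (real_complex R)) cmod_real. Qed.

Lemma average1 : (1 + 2%:R) / 3%:R = 1 :> R[i].
Proof. by rewrite -(natrD _ 1 2) mulfV// pnatr_eq0. Qed.

(** A weighted average with 1 of a value in the unit disc stays in it, away
    from 0, and lies on the unit circle only if the value is 1: this turns a
    function of norm 1 taking the value 1 into a peaking one. *)
Lemma cmod_average w : cmod ((w + 2%:R) / 3%:R) <= (cmod w + 2) / 3.
Proof.
rewrite cmodM cmodV cmod_nat ler_pM2r ?invr_gt0// -[in leRHS](cmod_nat 2%N).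
exact: cmodD.
Qed.

Lemma average_eq1 w :
  cmod w <= 1 -> cmod ((w + 2%:R) / 3%:R) = 1 -> w = 1.
Proof.
move=> w1; rewrite cmodM cmodV cmod_nat => e.
apply: (@cmodDZ_eq 1 w 2) => //; rewrite ?cmod1// mulr1 mulr1.
have -> : (2%:C%C : R[i]) = 2%:R by exact: rmorph_nat.
by rewrite -[LHS](@mulfVK _ 3) ?pnatr_eq0// e; lra.
Qed.

End Modulus.

(** * Maxima on compact spaces and operations in uniform algebras *)

Section UniformAlgebra.
Context {R : realType} {X : topologicalType}.
Hypothesis X_nonempty : [set: X] !=set0.
Hypothesis X_compact : compact [set: X].
Implicit Types f g h q : X -> R[i]^o.

Lemma continuous_cmod f : continuous f -> continuous (fun x => cmod (f x)).
Proof.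
move=> fc x; apply/cvgrPdist_lt => e e0.
have := fc x; move=> /cvgrPdist_lt/(_ e%:C%C).
rewrite ltcR => /(_ e0); apply: filterS => t /=.
rewrite normE ltcR; apply: le_lt_trans.
rewrite ler_norml cmod_lB andbT.
by rewrite lerNl opprB cmodBC cmod_lB.
Qed.

Lemma closed_superlevel (phi : X -> R) (c : R) :
  continuous phi -> closed [set x | c <= phi x].
Proof.
move=> /continuous_closedP phic.
exact: (phic [set y | c <= y] (@closed_ge R c)).
Qed.

Lemma closed_max (F : set X) (phi : X -> R) : closed F -> F !=set0 ->
  continuous phi -> exists2 x, F x & forall y, F y -> phi y <= phi x.
Proof.
move=> Fcl F0 phic.
have Fc : compact F by apply: subclosed_compact Fcl X_compact _.
have [|x xF xmax] := compact_EVT_max F0 Fc (f := phi).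
  exact: continuous_subspaceT.
by exists x => [|y yF]; [exact/set_mem|apply/xmax/mem_set].
Qed.

Lemma closed_lt1 (F : set X) (phi : X -> R) : closed F -> continuous phi ->
  (forall x, F x -> phi x < 1) ->
  exists2 rho, 0 < rho < 1 & forall x, F x -> phi x <= rho.
Proof.
move=> Fcl phic phi1.
have [->|/set0P F0] := eqVneq F set0; first by exists 2^-1 => //; lra.
have [x Fx xmax] := closed_max Fcl F0 phic.
exists (Num.max 2^-1 (phi x)); last first.
  by move=> y Fy; rewrite le_max xmax// orbT.
by rewrite lt_max gt_max phi1// invr_gt0 ltr0n/= invf_lt1 ?ltr1n.
Qed.

Lemma closed_small_pow (F : set X) (phi : X -> R) (e : R) : closed F ->
  continuous phi -> (forall x, 0 <= phi x) -> (forall x, F x -> phi x < 1) ->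
  0 < e -> exists k, forall x, F x -> phi x ^+ k.+1 <= e.
Proof.
move=> Fcl phic phi0 phi1 e0.
have [rho /andP[r0 r1] hr] := closed_lt1 Fcl phic phi1.
have : (geometric 1 rho) @ \oo --> (0 : R).
  by apply: cvg_geometric; rewrite ger0_norm// ltW.
move=> /cvgrPdist_lt/(_ e e0)[N _ /(_ N.+1 (leqnSn N))] /=.
rewrite sub0r normrN mul1r ger0_norm ?exprn_ge0 ?ltW// => hN.
exists N => x Fx; apply: le_trans (ltW hN).
by rewrite lerXn2r ?nnegrE ?phi0 ?hr// ltW.
Qed.

Lemma sup_norm_max f : continuous f ->
  exists2 x, cmod (f x) = sup_norm f & forall y, cmod (f y) <= sup_norm f.
Proof.
move=> /continuous_cmod fc.
have [x _ xmax] := closed_max closedT X_nonempty fc.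
have e : sup_norm f = cmod (f x).
  apply/eqP; rewrite eq_le; apply/andP; split.
    by apply: ge_sup => [|_ [y _ <-]]; [exists (cmod (f x)), x|exact: xmax].
  by apply: ub_le_sup; [exists (cmod (f x)) => _ [y _ <-]; exact: xmax|exists x].
by exists x => [//|y]; rewrite e xmax.
Qed.

Context {A : set (X -> R[i]^o)}.
Hypothesis UA : uniform_algebra A.

Lemma ua_limit f :
  (forall e, 0 < e -> exists2 g, A g & forall x, cmod (f x - g x) < e) -> A f.
Proof.
move=> h; apply: (ua_closed UA) => U /uniform_nbhs[E [+ sub]].
rewrite -entourage_ballE => -[e e0 be].
(* A positive radius in [R[i]] is a positive real number. *)
have e0' : 0 < complex.Re e.
  by move: e0 => /=; case: (e) => a b; rewrite ltcE/= => /andP[].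
have ee : e = (complex.Re e)%:C%C.
  move: e0 => /=; case: (e) => a b; rewrite ltcE/= => /andP[/eqP b0 _].
  by rewrite b0.
have [g Ag gf] := h _ e0'.
exists g; split => //; apply: sub => y _; apply: be => /=.
by rewrite /ball /= ee normE ltcR; exact: gf.
Qed.

Lemma ua_opp f : A f -> A (- f).
Proof. by move=> Af; rewrite -scaleN1r; exact: ua_scale. Qed.

Lemma ua_sub f g : A f -> A g -> A (f - g).
Proof. by move=> Af Ag; apply: ua_add => //; exact: ua_opp. Qed.

Lemma ua_one : A 1.
Proof. exact: (ua_cst UA 1). Qed.

Lemma ua_exp f n : A f -> A (f ^+ n).
Proof.
by move=> Af; elim: n => [|n IH]; rewrite ?expr0 ?exprS;
  [exact: ua_one|exact: ua_mul].
Qed.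

Lemma ua_sum (F : nat -> X -> R[i]^o) n :
  (forall i, A (F i)) -> A (\sum_(i < n) F i).
Proof.
move=> AF; elim: n => [|n IH]; first by rewrite big_ord0; exact: (ua_cst UA 0).
by rewrite big_ord_recr; exact: ua_add.
Qed.

Lemma fexpE f n x : (f ^+ n) x = f x ^+ n.
Proof. by elim: n => [|n IH]; rewrite ?expr0// !exprS -IH. Qed.

Lemma fsumE (F : nat -> X -> R[i]^o) n x :
  (\sum_(i < n) F i) x = \sum_(i < n) F i x.
Proof. by elim: n => [|n IH]; rewrite ?big_ord0// !big_ord_recr/= -IH. Qed.

Lemma inv_ua f : invertibles A f -> A f.
Proof. by case. Qed.

Lemma inv_neq0 f x : invertibles A f -> f x != 0.
Proof.
move=> [_ [g _ /(congr1 (fun u => u x))]]; rewrite /= fctE /= => e.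
apply/eqP => f0; move: e; rewrite /= f0 mul0r => /esym/eqP.
by rewrite oner_eq0.
Qed.

Lemma invertible_mul f g :
  invertibles A f -> invertibles A g -> invertibles A (f * g).
Proof.
move=> [Af [f' Af' ff']] [Ag [g' Ag' gg']]; split; first exact: ua_mul.
exists (f' * g'); first exact: ua_mul.
by rewrite mulrACA ff' gg' mulr1.
Qed.

Lemma invertible_exp f n : invertibles A f -> invertibles A (f ^+ n).
Proof.
move=> If; elim: n => [|n IH]; last by rewrite exprS; exact: invertible_mul.
by split; [exact: ua_one|exists 1; [exact: ua_one|rewrite mulr1]].
Qed.

Lemma invertible_cst (c : R[i]) : c != 0 -> invertibles A (cst c).
Proof.
move=> c0; split; first exact: ua_cst.
exists (cst c^-1); first exact: ua_cst.
by apply/funext => x; rewrite fctE /= mulfV.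
Qed.

Lemma invertible_scale (c : R[i]) f :
  c != 0 -> invertibles A f -> invertibles A (c *: f).
Proof.
move=> c0 If; rewrite (_ : c *: f = cst c * f); last exact/funext.
exact/invertible_mul/If/invertible_cst.
Qed.

Lemma neumann f (rho : R) : A f -> 0 < rho < 1 ->
  (forall x, cmod (f x) <= rho) -> A (fun x => (1 - f x)^-1).
Proof.
move=> Af /andP[r0 r1] fr; apply: ua_limit => e e0.
have : (geometric 1 rho) @ \oo --> (0 : R).
  by apply: cvg_geometric; rewrite ger0_norm// ltW.
have er0 : 0 < e * (1 - rho) by rewrite mulr_gt0// subr_gt0.
move=> /cvgrPdist_lt/(_ _ er0)[N _ /(_ N (leqnn N))] /=.
rewrite sub0r normrN mul1r ger0_norm ?exprn_ge0 ?ltW// => hN.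
exists (\sum_(i < N) f ^+ i); first by apply: ua_sum => i; exact: ua_exp.
move=> x.
have d0 : 1 - rho <= cmod (1 - f x).
  by rewrite (le_trans _ (cmod_lB _ _))// cmod1 lerD2l lerN2.
have d1 : 0 < cmod (1 - f x) by rewrite (lt_le_trans _ d0)// subr_gt0.
have f1 : f x != 1 by rewrite eq_sym -subr_eq0 -cmod_gt0.
have -> : (\sum_(i < N) f ^+ i) x = \sum_(i < N) f x ^+ i.
  by rewrite (fsumE (fun i => f ^+ i)); apply: eq_bigr => i _; exact: fexpE.
rewrite geometric_sum// -[X in X - _]mul1r -mulrBl opprB addrC subrK.
rewrite cmodM cmodX cmodV ltr_pdivrMr//.
rewrite (le_lt_trans (y := rho ^+ N))//.
  by rewrite lerXn2r ?nnegrE ?cmod_ge0// ltW.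
by rewrite (lt_le_trans hN)// ler_pM2l.
Qed.

End UniformAlgebra.

(** * Spectrum and sup norm *)

Section Spectrum.
Context {R : realType} {X : topologicalType}.
Hypothesis X_nonempty : [set: X] !=set0.
Hypothesis X_compact : compact [set: X].
Implicit Types f g : X -> R[i]^o.
Context {A : set (X -> R[i]^o)}.
Hypothesis UA : uniform_algebra A.

(** After scaling, [z] is 1 and [f] is a function [p] into the closed unit disc
    that avoids 1.  For [r < 1] the Neumann series inverts [1 - r p], and these
    inverses converge uniformly to that of [1 - p] as [r] tends to 1, since
    [1 - p] is bounded away from 0. *)
Lemma invertible_sub f (z : R[i]) : A f -> (forall x, cmod (f x) <= cmod z) ->
  (forall x, f x != z) -> invertibles A (f - cst z).
Proof.
move=> Af fz fnz.
have z0 : z != 0.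
  have [x _] := X_nonempty; apply: contra (fnz x) => /eqP z0.
  by have := fz x; rewrite z0 cmod0 -cmod_eq0 eq_le cmod_ge0 andbT.
pose p : X -> R[i]^o := z^-1 *: f.
have Ap : A p by exact: ua_scale.
have pE x : p x = z^-1 * f x by [].
have p1 x : cmod (p x) <= 1.
  by rewrite pE cmodM cmodV ler_pdivrMl ?cmod_gt0// mulr1.
have pn1 x : 1 - p x != 0.
  rewrite subr_eq0 eq_sym; apply: contra (fnz x); rewrite pE => /eqP e.
  by rewrite -[z]mulr1 -e mulrA mulfV// mul1r.
have [x1 _ hx1] : exists2 x, [set: X] x & forall y, [set: X] y ->
    - cmod (1 - p y) <= - cmod (1 - p x).
  apply: (closed_max X_compact closedT X_nonempty) => x.
  apply: cvgN; apply: (@continuous_cmod _ _ (1 - p)).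
  by apply: (ua_continuous UA); apply: (ua_sub UA) => //; exact: ua_one.
set d := cmod (1 - p x1) in hx1.
have d0 : 0 < d by rewrite cmod_gt0.
have {}hx1 y : d <= cmod (1 - p y) by rewrite -lerN2 hx1.
have AF : A (fun x => (1 - p x)^-1).
  apply: (ua_limit UA) => e e0.
  pose t := Num.min 2^-1 (e * d ^+ 2 / 4).
  have ed0 : 0 < e * d ^+ 2 / 4 by rewrite !mulr_gt0// ?exprn_gt0// invr_gt0.
  have t0 : 0 < t by rewrite lt_min ed0 invr_gt0 ltr0n.
  have t1 : t <= 2^-1 by rewrite ge_min lexx.
  have te : t <= e * d ^+ 2 / 4 by rewrite ge_min lexx orbT.
  pose r : R := 1 - t.
  have r01 : 0 < r < 1 by rewrite /r; lra.
  have [r0 r1] := andP r01.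
  exists (fun x => (1 - (r%:C%C *: p) x)^-1).
    apply: (neumann UA (rho := r)) => //; first exact: ua_scale.
    move=> x; rewrite (_ : (r%:C%C *: p) x = r%:C%C * p x)//.
    rewrite cmodM cmod_real ?(ltW r0)//.
    by rewrite ler_piMr// ltW.
  move=> x.
  have -> : (r%:C%C *: p) x = r%:C%C * p x by [].
  have tC : (1 - r%:C%C : R[i]) = t%:C%C.
    by rewrite /r rmorphB rmorph1 opprB addrC subrK.
  (* Since t <= 1 - r |p|, moving p to r p at most halves the distance to 1. *)
  have half : d / 2 <= cmod (1 - r%:C%C * p x).
    have h1 : t <= cmod (1 - r%:C%C * p x).
      apply: le_trans (cmod_lB _ _); rewrite cmod1 cmodM cmod_real ?(ltW r0)//.
      by have : r * cmod (p x) <= r by [rewrite ler_piMr// ltW]; rewrite /r; lra.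
    have h2 : cmod (1 - p x) <= cmod (1 - r%:C%C * p x) + t.
      have -> : 1 - p x = (1 - r%:C%C * p x) - t%:C%C * p x.
        by rewrite -tC; ring.
      apply: le_trans (cmodB _ _) _; rewrite lerD2l cmodM cmod_real ?(ltW t0)//.
      by rewrite ler_piMr// ltW.
    by have := hx1 x; lra.
  have h0 : 1 - r%:C%C * p x != 0.
    by rewrite -cmod_gt0 (lt_le_trans _ half)// divr_gt0.
  have -> : (1 - p x)^-1 - (1 - r%:C%C * p x)^-1 =
      t%:C%C * p x / ((1 - p x) * (1 - r%:C%C * p x)).
    by rewrite -tC; field; rewrite h0 pn1.
  rewrite cmodM cmodV (cmodM t%:C%C) (cmodM (1 - p x)) cmod_real ?(ltW t0)//.
  rewrite ltr_pdivrMr ?mulr_gt0 ?cmod_gt0//.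
  apply: (@le_lt_trans _ _ t).
    exact: ler_piMr (ltW t0) (p1 x).
  apply: (@lt_le_trans _ _ (e * (d * (d / 2)))).
    by move: te; rewrite expr2; nra.
  rewrite ler_pM2l// ler_pM// ?ltW// divr_gt0//.
split; first by apply: (ua_sub UA) => //; exact: ua_cst.
exists ((- z)^-1 *: (fun x => (1 - p x)^-1 : R[i]^o)); first exact: ua_scale.
apply/funext => x.
rewrite [LHS](_ : _ = (f - cst z) x * ((- z)^-1 * (1 - p x)^-1))//.
rewrite (_ : (f - cst z) x = - z * (1 - p x)); last first.
  by rewrite mulrBr mulr1 !mulNr opprK pE mulrA mulfV// mul1r addrC.
have nz0 : - z != 0 by rewrite oppr_eq0.
by rewrite mulrACA !mulfV// mulr1.
Qed.

Lemma spectrum_value f x : spectrum A f (f x).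
Proof.
by move=> /(inv_neq0 x)/negP; apply; rewrite [X in X == 0](subrr (f x)).
Qed.

Lemma spectrum_max f z : A f -> spectrum A f z -> sup_norm f <= cmod z ->
  exists x, f x = z.
Proof.
move=> Af sz Nz; apply: contrapT => nx; apply: sz; apply: invertible_sub => //.
  have [_ _ h] := sup_norm_max X_nonempty X_compact (ua_continuous UA Af).
  by move=> x; exact: le_trans (h x) Nz.
by move=> x; apply/eqP => e; apply: nx; exists x.
Qed.

Lemma spectral_radiusE f : A f -> spectral_radius A f = sup_norm f.
Proof.
move=> Af.
have [x xN fN] := sup_norm_max X_nonempty X_compact (ua_continuous UA Af).
have ub z : spectrum A f z -> cmod z <= sup_norm f.
  move=> sz; rewrite leNgt; apply/negP => lt.
  by have [y fy] := spectrum_max Af sz (ltW lt); move: lt; rewrite -fy ltNge fN.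
apply/eqP; rewrite eq_le; apply/andP; split.
  apply: ge_sup => [|_ [z sz <-]]; last exact: ub.
  by exists (cmod (f x)), (f x) => //; exact: spectrum_value.
rewrite -xN; apply: ub_le_sup.
  by exists (sup_norm f) => _ [z sz <-]; exact: ub.
by exists (f x) => //; exact: spectrum_value.
Qed.

Lemma peripheralP f z : A f ->
  peripheral_spectrum A f z <-> exists2 x, f x = z & cmod (f x) = sup_norm f.
Proof.
move=> Af; rewrite /peripheral_spectrum /= spectral_radiusE//; split.
  move=> [sz Nz]; have [|x fx] := spectrum_max Af sz; first by rewrite Nz.
  by exists x; rewrite ?fx.
by move=> [x <- ?]; split => //; exact: spectrum_value.
Qed.

Lemma cmod_le_sup_norm f x : A f -> cmod (f x) <= sup_norm f.
Proof.
by move=> /(ua_continuous UA)/(sup_norm_max X_nonempty X_compact)[_ _]; apply.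
Qed.

Lemma sup_norm_attained f : A f -> exists x, cmod (f x) = sup_norm f.
Proof.
by move=> /(ua_continuous UA)/(sup_norm_max X_nonempty X_compact)[x]; exists x.
Qed.

Lemma sup_norm_le f (r : R) :
  A f -> (forall x, cmod (f x) <= r) -> sup_norm f <= r.
Proof. by move=> /sup_norm_attained[x <-]; apply. Qed.

Lemma sup_norm_ge0 f : A f -> 0 <= sup_norm f.
Proof. by move=> /sup_norm_attained[x <-]; exact: cmod_ge0. Qed.

Lemma sup_normD f g : A f -> A g -> sup_norm (f + g) <= sup_norm f + sup_norm g.
Proof.
move=> Af Ag; apply: sup_norm_le; first exact: ua_add.
by move=> x; apply: le_trans (cmodD _ _) _; rewrite lerD// cmod_le_sup_norm.
Qed.

Lemma invertible_shift f (c : R[i]) :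
  A f -> sup_norm f < cmod c -> invertibles A (f + cst c).
Proof.
move=> Af fc; rewrite (_ : cst c = - cst (- c)); last first.
  by apply/funext => x; rewrite -[LHS]opprK.
apply: invertible_sub => // x.
  by rewrite cmodN ltW// (le_lt_trans (cmod_le_sup_norm _ Af)).
apply/eqP => e; have := cmod_le_sup_norm x Af.
by rewrite e cmodN leNgt fc.
Qed.

End Spectrum.

(** * Peaking functions *)

Definition peaking (R : realType) (X : Type) (A : set (X -> R[i]^o))
    (q : X -> R[i]^o) : Prop :=
  [/\ invertibles A q, forall x, cmod (q x) <= 1,
      forall x, cmod (q x) = 1 -> q x = 1 & exists x, q x = 1].

Section Peaking.
Context {R : realType} {X : topologicalType}.
Hypothesis X_nonempty : [set: X] !=set0.
Hypothesis X_compact : compact [set: X].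
Implicit Types f g h q : X -> R[i]^o.
Context {A : set (X -> R[i]^o)}.
Hypothesis UA : uniform_algebra A.

Lemma invertible_average f : A f -> (forall x, cmod (f x) <= 1) ->
  invertibles A (fun x => (f x + 2%:R) / 3%:R).
Proof.
move=> Af f1.
have -> : (fun x => (f x + 2%:R) / 3%:R) =
    3%:R^-1 *: (f - cst (- 2%:R)) :> (X -> R[i]^o).
  by apply/funext => x; rewrite mulrC -[X in f x + X]opprK.
apply: (invertible_scale UA); first by rewrite invr_eq0 pnatr_eq0.
apply: (invertible_sub X_nonempty X_compact UA) => // x.
  by rewrite cmodN cmod_nat (le_trans (f1 x)) ?ler1n.
by apply/eqP => e; have := f1 x; rewrite e cmodN cmod_nat lern1.
Qed.

Lemma peak_at_max h x0 : A h -> h x0 != 0 ->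
  (forall x, cmod (h x) <= cmod (h x0)) ->
  exists2 q, peaking A q & forall x, q x = 1 <-> h x = h x0.
Proof.
move=> Ah h0 hmax.
pose u : X -> R[i]^o := (h x0)^-1 *: h.
have Au : A u by exact: ua_scale.
have u1 x : cmod (u x) <= 1.
  rewrite (_ : u x = (h x0)^-1 * h x)// cmodM cmodV.
  by rewrite ler_pdivrMl ?cmod_gt0// mulr1.
pose q : X -> R[i]^o := fun x => (u x + 2%:R) / 3%:R.
have u1E x : u x = 1 <-> h x = h x0.
  rewrite (_ : u x = (h x0)^-1 * h x)//; split => [e|->]; last by rewrite mulVf.
  by rewrite -[RHS]mulr1 -e mulrA mulfV// mul1r.
have q1 x : u x = 1 -> q x = 1.
  by move=> e; rewrite /q e average1.
have q1u x : cmod (q x) = 1 -> u x = 1 by exact: average_eq1.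
exists q; last first.
  move=> x; rewrite -u1E; split; last exact: q1.
  by move=> e; apply: q1u; rewrite e cmod1.
split; first exact: invertible_average.
- move=> x; apply: le_trans (cmod_average _) _.
  by have := u1 x; lra.
- by move=> x /q1u/q1.
- by exists x0; apply/q1/u1E.
Qed.

(** Write [M] for [cmod (f x0)] and [F j] for the closed set where the modulus
    of [f] is at least [M (1 + 2^-j / 24)]; there [q] has modulus less than 1.  For
    suitable powers [k j], the series [l] of the functions
    [2^-(j+1) q ^ (k j + 1)] is 1 on [{q = 1}] and has modulus at most
    [1 - 2^-j / 4] on [F j], hence its average [q2 = (l + 2) / 3] has modulus at
    most [1 - 2^-j / 12] on [F j].  If [j > 0] is the first index with [x] in
    [F j], then [x] is not in [F (j - 1)], and [(1 + t) (1 - t) < 1] with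
    [t = 2^-j / 12] bounds [q2 f].  A further power of [q] takes care of
    [F 0]. *)
Lemma bishop_peak q f x0 : peaking A q -> invertibles A f -> q x0 = 1 ->
  (forall x, q x = 1 -> cmod (f x) <= cmod (f x0)) ->
  exists2 q', peaking A q' & forall x,
    (q x = 1 -> q' x = 1) /\
    (q x <> 1 -> cmod (q' x * f x) < cmod (f x0)).
Proof.
move=> [Iq q1 q1E _] If qx0 fmax.
set M := cmod (f x0) in fmax *.
have M0 : 0 < M by rewrite cmod_gt0 (inv_neq0 _ If).
have qc : continuous (fun x => cmod (q x)).
  exact/continuous_cmod/(ua_continuous UA)/inv_ua.
have fc : continuous (fun x => cmod (f x)).
  exact/continuous_cmod/(ua_continuous UA)/inv_ua.
pose v n := 2^-1 ^+ n : R.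
have v0 n : 0 < v n by rewrite exprn_gt0.
have vS n : v n.+1 = v n / 2 by rewrite /v exprS mulrC.
pose F j := [set x | M * (1 + v j / 24) <= cmod (f x)].
have Fcl j : closed (F j).
  exact: (closed_superlevel (c := M * (1 + v j / 24)) fc).
have qlt x : q x <> 1 -> cmod (q x) < 1.
  by move=> qx; rewrite lt_neqAle q1 andbT; apply/eqP => /q1E.
have qF j x : F j x -> cmod (q x) < 1.
  move=> Fx; apply: qlt => /fmax fM; move: Fx; rewrite /F /= leNgt => /negP; apply.
  by have := v0 j; nra.
have /choice[k hk] : forall j, exists k, forall x, F j x ->
    cmod (q x) ^+ k.+1 <= 2^-1.
  move=> j; apply: (closed_small_pow X_compact (Fcl j) qc) => //.
  - by move=> x; exact: cmod_ge0.
  - exact: qF.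
have fN x := cmod_le_sup_norm X_nonempty X_compact UA x (inv_ua If).
have N0 : 0 < sup_norm f by exact: lt_le_trans M0 (fN x0).
have [K hK] : exists K, forall x, F 0%N x ->
    cmod (q x) ^+ K.+1 <= M / (2 * sup_norm f).
  apply: (closed_small_pow X_compact (Fcl 0%N) qc).
  - by move=> x; exact: cmod_ge0.
  - exact: qF.
  - by rewrite divr_gt0// mulr_gt0.
pose u n : X -> R[i]^o := \sum_(j < n) (v j.+1)%:C%C *: q ^+ (k j).+1.
have Au n : A (u n).
  apply: (ua_sum UA (F := fun j => (v j.+1)%:C%C *: q ^+ (k j).+1)) => j.
  by apply: (ua_scale UA); apply: (ua_exp UA); exact: inv_ua.
have u0 x : u 0%N x = 0 by rewrite /u big_ord0.
have uS n x : u n.+1 x = u n x + (v n.+1)%:C%C * q x ^+ (k n).+1.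
  by rewrite /u big_ord_recr/= -(fexpE q).
have q01 x n : cmod (q x) ^+ n <= 1 by rewrite exprn_ile1// cmod_ge0.
have termE n x : cmod ((v n.+1)%:C%C * q x ^+ (k n).+1) =
    v n.+1 * cmod (q x) ^+ (k n).+1.
  by rewrite cmodM cmodX cmod_real// ltW.
have /choice[l hl] : forall x, exists l, forall n, cmod (l - u n x) <= 2 * v n.
  move=> x; apply: complex_half_cvg => n.
  by rewrite uS addrAC subrr add0r termE ler_piMr// ltW.
have Al : A l.
  apply: (ua_limit UA) => e e0.
  have [n hn] : exists n, 2 * v n < e.
    apply: contrapT => /forallNP h.
    suff : e <= 0 by rewrite leNgt e0.
    by apply: (@le_half_pow _ _ _ 2) => n; rewrite add0r leNgt; apply/negP/h.
  by exists (u n) => // x; exact: le_lt_trans (hl x n) hn.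
have ub n x : cmod (u n x) <= 1 - v n.
  elim: n => [|n IH]; first by rewrite u0 cmod0 /v expr0 subrr.
  rewrite uS (le_trans (cmodD _ _))// termE.
  have : v n.+1 * cmod (q x) ^+ (k n).+1 <= v n.+1 by rewrite ler_piMr// ltW.
  by move: IH; rewrite vS; lra.
have ubF j n x : F j x -> cmod (u (n + j.+1)%N x) <= 1 - v j / 4.
  move=> Fx; suff : cmod (u (n + j.+1)%N x) <= 1 - v j / 4 - v (n + j.+1)%N.
    by have := v0 (n + j.+1)%N; lra.
  (* The base case adds the one term that is small on [F j]. *)
  elim: n => [|n IH]; rewrite ?add0n ?addSn uS (le_trans (cmodD _ _))// termE.
    have := ub j x; have : v j.+1 * cmod (q x) ^+ (k j).+1 <= v j.+1 * 2^-1.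
      by rewrite ler_pM2l// hk.
    by rewrite vS; lra.
  have : v (n + j.+1).+1 * cmod (q x) ^+ (k (n + j.+1)%N).+1 <= v (n + j.+1).+1.
    by rewrite ler_piMr// ltW.
  by move: IH; rewrite (vS (n + j.+1)%N); lra.
have lu n x : cmod (l x) <= cmod (u n x) + 2 * v n.
  by rewrite -[l x](subrK (u n x)) addrC (le_trans (cmodD _ _))// lerD2l.
have l1 x : cmod (l x) <= 1.
  apply: (@le_half_pow _ _ _ 2) => n; apply: le_trans (lu n x) _.
  by have := ub n x; have := v0 n; rewrite /v; lra.
have lF j x : F j x -> cmod (l x) <= 1 - v j / 4.
  move=> Fx; apply: (@le_half_pow _ _ _ 2) => n.
  apply: le_trans (lu (n + j.+1)%N x) _; rewrite lerD ?ubF// ler_pM2l//.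
  by rewrite /v exprD ler_piMr ?exprn_ge0// exprn_ile1// invf_le1 ?ler1n.
have l1E x : q x = 1 -> l x = 1.
  move=> qx; have uE n : u n x = 1 - (v n)%:C%C.
    elim: n => [|n IH]; first by rewrite u0 /v expr0 rmorph1 subrr.
    rewrite uS IH qx expr1n mulr1 [v n](_ : _ = v n.+1 + v n.+1) ?rmorphD.
      by ring.
    by rewrite vS; lra.
  apply/eqP; rewrite -subr_eq0 -cmod_eq0 eq_le cmod_ge0 andbT.
  apply: (@le_half_pow _ _ _ 3) => n; rewrite add0r.
  have -> : l x - 1 = l x - u n x - (v n)%:C%C by rewrite uE; ring.
  apply: le_trans (cmodB _ _) _; rewrite cmod_real ?(ltW (v0 n))//.
  by have := hl x n; rewrite /v; lra.
pose q2 : X -> R[i]^o := fun x => (l x + 2%:R) / 3%:R.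
have q2le x : cmod (q2 x) <= (cmod (l x) + 2) / 3 by exact: cmod_average.
have q21 x : cmod (q2 x) <= 1 by apply: le_trans (q2le x) _; have := l1 x; lra.
pose q' : X -> R[i]^o := q2 * q ^+ K.+1.
have q'E x : q' x = q2 x * q x ^+ K.+1 by rewrite -fexpE.
have q'1 x : q x = 1 -> q' x = 1.
  by move=> qx; rewrite q'E qx expr1n mulr1 /q2 l1E// average1.
have q'le x : cmod (q' x) <= cmod (q x) ^+ K.+1.
  by rewrite q'E cmodM cmodX ler_piMl ?exprn_ge0 ?cmod_ge0.
have q'lt x : q x <> 1 -> cmod (q' x) < 1.
  move=> /qlt qx; apply: le_lt_trans (q'le x) _.
  by rewrite exprn_ilt1 ?cmod_ge0.
exists q'.
  split.
  - apply: (invertible_mul UA); first exact: invertible_average.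
    exact: invertible_exp.
  - by move=> x; exact: le_trans (q'le x) _.
  - move=> x e; have [/q'1//|/q'lt] := pselect (q x = 1).
    by rewrite e ltxx.
  - by exists x0; exact: q'1.
move=> x; split; first exact: q'1.
move=> qx; rewrite cmodM.
have f0 : 0 < cmod (f x) by rewrite cmod_gt0 (inv_neq0 _ If).
have [F0|nF0] := pselect (F 0%N x).
  apply: (@le_lt_trans _ _ (M / 2)); last by lra.
  apply: (@le_trans _ _ (M / (2 * sup_norm f) * sup_norm f)).
    by rewrite ler_pM ?cmod_ge0// (le_trans (q'le x))// hK.
  by rewrite invfM mulrA mulfVK// gt_eqF.
have [[j Fj]|/forallNP nF] := pselect (exists j, F j x).
  have : exists j, `[< F j x >] by exists j; apply/asboolP.
  move=> /ex_minnP[[|m] /asboolP Fm mmin]; first by [].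
  have : ~ F m x by move=> /asboolP/mmin; rewrite ltnn.
  rewrite /F /= => /negP; rewrite -ltNge => fm.
  have q'm : cmod (q' x) <= 1 - v m / 24.
    apply: (@le_trans _ _ (cmod (q2 x))).
      by rewrite q'E cmodM cmodX ler_piMr ?cmod_ge0.
    by apply: le_trans (q2le x) _; have := lF _ _ Fm; rewrite vS; lra.
  apply: (@le_lt_trans _ _ ((1 - v m / 24) * cmod (f x))).
    by rewrite ler_pM2r.
  have vm1 : v m <= 1 by rewrite exprn_ile1// invf_le1 ?ler1n.
  apply: (@lt_trans _ _ ((1 - v m / 24) * (M * (1 + v m / 24)))).
    by rewrite ltr_pM2l//; have := v0 m; lra.
  rewrite mulrCA gtr_pMr//.
  by have := v0 m; nra.
have fM : cmod (f x) <= M.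
  apply: (@le_half_pow _ _ _ (M / 24)) => n; have := nF n.
  by rewrite /F /= => /negP; rewrite -ltNge => /ltW; rewrite -/(v n); lra.
by apply: lt_le_trans fM; rewrite gtr_pMl// q'lt.
Qed.

(** The translate [f + s z] of [f], with [z] a value of largest modulus on the
    peak set, is invertible for large [s] and attains its largest modulus there
    only where [f] equals [z]; damping it by Bishop's lemma makes this a global
    maximum. *)
Lemma constant_peak q f : peaking A q -> A f ->
  exists q' z, [/\ peaking A q', forall x, q' x = 1 -> q x = 1 &
    forall x, q' x = 1 -> f x = z].
Proof.
move=> pq Af; have [Iq q1 q1E [y0 qy0]] := pq.
have qc : continuous (fun x => cmod (q x)).
  exact/continuous_cmod/(ua_continuous UA)/inv_ua.
have fc : continuous (fun x => cmod (f x)).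
  exact/continuous_cmod/(ua_continuous UA).
pose E := [set x | 1 <= cmod (q x)].
have EP x : E x <-> q x = 1.
  split => [/= h|e]; last by rewrite /E /= e cmod1.
  by apply: q1E; apply/eqP; rewrite eq_le q1.
have Ecl : closed E by exact: (closed_superlevel (c := 1) qc).
have E0 : E !=set0 by exists y0; apply/EP.
have [x1 /EP qx1 fmax] := closed_max X_compact Ecl E0 fc.
have {}fmax x : q x = 1 -> cmod (f x) <= cmod (f x1) by move=> /EP/fmax.
set z := f x1 in fmax.
have [z0|z0] := eqVneq z 0.
  exists q, 0; split => // x /fmax; rewrite z0 cmod0 => h.
  by apply/eqP; rewrite -cmod_eq0 eq_le h cmod_ge0.
have z0' : 0 < cmod z by rewrite cmod_gt0.
have fN x := cmod_le_sup_norm X_nonempty X_compact UA x Af.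
have N0 : 0 <= sup_norm f by exact: (sup_norm_ge0 X_nonempty X_compact UA).
have [s s0 sN] : exists2 s, 0 < s & sup_norm f < s * cmod z.
  exists (1 + sup_norm f / cmod z); first by rewrite ltr_pwDl// divr_ge0// ltW.
  by rewrite mulrDl mul1r mulfVK ?gt_eqF// ltrDr.
pose w : R[i] := s%:C%C * z.
have wE : cmod w = s * cmod z by rewrite cmodM cmod_real// ltW.
pose g : X -> R[i]^o := f - cst (- w).
have gE x : g x = f x + w by rewrite -[w in RHS]opprK.
have Ig : invertibles A g.
  apply: (invertible_sub X_nonempty X_compact UA) => // x.
    by rewrite cmodN wE ltW// (le_lt_trans (fN x)).
  by apply/eqP => e; have := fN x; rewrite e cmodN wE leNgt sN.
have gx1 : cmod (g x1) = (1 + s) * cmod z.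
  have -> : g x1 = (1 + s)%:C%C * z by rewrite gE /w rmorphD rmorph1 mulrDl mul1r.
  by rewrite cmodM cmod_real// addr_ge0// ltW.
have gmax x : q x = 1 -> cmod (g x) <= cmod (g x1).
  move=> /fmax h; rewrite gx1 gE (le_trans (cmodD _ _))// wE mulrDl mul1r.
  by rewrite lerD2r.
have [p [Ip _ _ _] hp] := bishop_peak pq Ig qx1 gmax.
pose h : X -> R[i]^o := p * g.
have hE x : h x = p x * g x by [].
have hx1 : h x1 = g x1 by rewrite hE (hp x1).1// mul1r.
have Ih : invertibles A h by exact: invertible_mul.
have hmax x : cmod (h x) <= cmod (h x1).
  rewrite hx1 hE; have [qx|qx] := pselect (q x = 1).
    by rewrite (hp x).1// mul1r gmax.
  exact/ltW/(hp x).2.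
have [q' pq' hq'] := peak_at_max (inv_ua Ih) (inv_neq0 x1 Ih) hmax.
have q'q x : q' x = 1 -> q x = 1.
  move=> /hq' e; apply: contrapT => /(hp x).2.
  by rewrite -hE e hx1 ltxx.
exists q', z; split => // x q'x; have qx := q'q _ q'x.
apply: (cmodDZ_eq s0 (fmax x qx)).
by rewrite -gx1 -hx1 -((hq' x).1 q'x) hE (hp x).1// mul1r gE.
Qed.

End Peaking.

(** * Additivity of the homomorphism *)

Section PeripheralHomomorphism.
Context {R : realType} {X Y : topologicalType}.
Hypothesis X_nonempty : [set: X] !=set0.
Hypothesis Y_nonempty : [set: Y] !=set0.
Hypothesis X_compact : compact [set: X].
Hypothesis Y_compact : compact [set: Y].
Context {A : set (X -> R[i]^o)} {B : set (Y -> R[i]^o)}.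
Hypothesis UA : uniform_algebra A.
Hypothesis UB : uniform_algebra B.
Context {T : (X -> R[i]^o) -> (Y -> R[i]^o)}.
Hypothesis T_hom : group_hom_onto A B T.
Hypothesis T_spec : forall f, invertibles A f ->
  peripheral_spectrum B (T f) `<=` peripheral_spectrum A f.
Implicit Types f g q : X -> R[i]^o.

Lemma hom_inv f : invertibles A f -> invertibles B (T f).
Proof. by case: T_hom => h _ _ /h. Qed.

Lemma homM f g : invertibles A f -> invertibles A g -> T (f * g) = T f * T g.
Proof. by case: T_hom => _ h _; exact: h. Qed.

Lemma hom_onto k : invertibles B k -> exists2 g, invertibles A g & T g = k.
Proof. by case: T_hom => _ _ h /h. Qed.

Lemma hom_max_value f y : invertibles A f -> cmod (T f y) = sup_norm (T f) ->
  exists2 x, f x = T f y & cmod (f x) = sup_norm f.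
Proof.
move=> If e.
apply/(peripheralP X_nonempty X_compact UA); first exact: inv_ua.
apply: (T_spec If).
apply/(peripheralP Y_nonempty Y_compact UB); first exact/inv_ua/hom_inv.
by exists y.
Qed.

Lemma hom_norm f : invertibles A f -> sup_norm (T f) = sup_norm f.
Proof.
move=> If.
have [y e] := sup_norm_attained Y_nonempty Y_compact UB (inv_ua (hom_inv If)).
by have [x fx <-] := hom_max_value If e; rewrite fx e.
Qed.

Lemma hom_le f y (r : R) :
  invertibles A f -> (forall x, cmod (f x) <= r) -> cmod (T f y) <= r.
Proof.
move=> If fr.
have BTf := inv_ua (hom_inv If).
apply: le_trans (cmod_le_sup_norm Y_nonempty Y_compact UB y BTf) _.
by rewrite hom_norm// (sup_norm_le X_nonempty X_compact UA (inv_ua If)).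
Qed.

Lemma hom1 : T 1 = 1.
Proof.
have I1 : invertibles A 1 by exact: (invertible_cst UA (oner_neq0 _)).
have [_ [g _ e]] := hom_inv I1.
by rewrite -[LHS]mulr1 -e mulrA -homM// mulr1.
Qed.

(** Both [T c] and its inverse [T c^-1] are bounded by the modulus of their
    constants, so [T c] has constant modulus; each of its values is therefore of
    largest modulus, hence a value of the constant function [c]. *)
Lemma hom_cst (c : R[i]) : c != 0 -> T (cst c) = cst c.
Proof.
move=> c0; have Ic : invertibles A (cst c) by exact: invertible_cst.
have Ic' : invertibles A (cst c^-1).
  by apply: (invertible_cst UA); rewrite invr_eq0.
apply/funext => y.
have le1 : cmod (T (cst c) y) <= cmod c by exact: hom_le.
have le2 : cmod (T (cst c^-1) y) <= cmod c^-1 by exact: hom_le.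
have e1 : T (cst c) y * T (cst c^-1) y = 1.
  rewrite (_ : _ * _ = (T (cst c) * T (cst c^-1)) y)// -homM//.
  rewrite (_ : cst c * cst c^-1 = 1) ?hom1//.
  by apply/funext => x; exact: mulfV.
have cc : 0 < cmod c by rewrite cmod_gt0.
have e : cmod (T (cst c) y) = cmod c.
  apply/eqP; rewrite eq_le le1 /=.
  have : cmod (T (cst c) y) * cmod (T (cst c^-1) y) = 1 by rewrite -cmodM e1 cmod1.
  move=> h; rewrite -[leLHS]mulr1 -h mulrCA ler_piMr ?cmod_ge0//.
  by rewrite -(@mulfV _ (cmod c)) ?gt_eqF// ler_pM2l// -cmodV.
have Nc : sup_norm (cst c : X -> R[i]^o) = cmod c.
  by have [x <-] := sup_norm_attained X_nonempty X_compact UA (ua_cst UA c).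
have [] := @hom_max_value (cst c) y => //.
by rewrite e hom_norm// Nc.
Qed.

(** With [q'] from Bishop's lemma, all products of [f] with at least one [q']
    and any powers of [q'] and [g] have norm [cmod z].  Comparing two of them,
    [p1] and [p2], at a point where [T p2] is largest forces [T q'] and
    [T g] to have modulus 1 there, hence to be 1.  So [T (q' f)] takes there
    the value of [T f], which is of largest modulus and hence a value of
    [q' f] of largest modulus; such values are only taken on [{q = 1}]. *)
Lemma peak_value_transport f g q z : invertibles A f -> invertibles A g ->
  peaking B (T g) -> (forall x, cmod (g x) <= 1) -> peaking A q ->
  (forall x, q x = 1 -> cmod (g x) = 1) -> (forall x, q x = 1 -> f x = z) ->
  exists2 y, T g y = 1 & T f y = z.
Proof.
move=> If Ig [_ _ Tg1 _] g1 pq gq fz.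
have [_ _ _ [x0 qx0]] := pq.
have fmax x : q x = 1 -> cmod (f x) <= cmod (f x0) by move=> qx; rewrite !fz.
have [q' [Iq' q'1 q'1E _] hq'] :=
  bishop_peak X_nonempty X_compact UA pq If qx0 fmax.
move: hq'; rewrite (fz _ qx0) => hq'.
set M := cmod z in hq'.
have M0 : 0 < M by rewrite cmod_gt0 -(fz x0 qx0) (inv_neq0 _ If).
have q'f x : cmod (q' x * f x) <= M.
  have [qx|qx] := pselect (q x = 1); last exact/ltW/(hq' x).2.
  by rewrite (hq' x).1// mul1r fz.
pose p1 := q' * f * g; pose p2 := p1 * (q' * g).
have I'f : invertibles A (q' * f) by exact: invertible_mul.
have I'g : invertibles A (q' * g) by exact: invertible_mul.
have I1 : invertibles A p1 by exact: invertible_mul.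
have I2 : invertibles A p2 by exact: invertible_mul.
have p1M x : cmod (p1 x) <= M.
  rewrite (_ : p1 x = q' x * f x * g x)// cmodM.
  by rewrite (le_trans _ (q'f x))// ler_piMr ?cmod_ge0.
have [y yM] := sup_norm_attained Y_nonempty Y_compact UB (inv_ua (hom_inv I2)).
have My : M <= cmod (T p2 y).
  rewrite yM hom_norm//.
  apply: le_trans (cmod_le_sup_norm X_nonempty X_compact UA x0 (inv_ua I2)).
  rewrite (_ : p2 x0 = q' x0 * f x0 * g x0 * (q' x0 * g x0))//.
  by rewrite !cmodM gq// (hq' x0).1// cmod1 fz// !mul1r !mulr1.
have Tp2 : T p2 y = T p1 y * (T q' y * T g y) by rewrite /p2 homM// (homM Iq' Ig).
have Tp1 : T p1 y = T q' y * T f y * T g y by rewrite /p1 homM// (homM Iq' If).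
have a1 : cmod (T q' y) <= 1 by exact: hom_le.
have b1 : cmod (T g y) <= 1 by exact: hom_le.
have c1 : cmod (T p1 y) <= M by exact: hom_le.
move: My; rewrite Tp2 !cmodM => My.
have a0 := cmod_ge0 (T q' y); have b0 := cmod_ge0 (T g y).
have ab : 1 <= cmod (T q' y) * cmod (T g y).
  by rewrite -(ler_pM2l M0) mulr1 (le_trans My)// ler_wpM2r// mulr_ge0.
have aE : cmod (T q' y) = 1.
  by apply/eqP; rewrite eq_le a1 (le_trans ab)// ler_piMr.
have bE : cmod (T g y) = 1.
  by apply/eqP; rewrite eq_le b1 (le_trans ab)// ler_piMl.
have Tq'y : T q' y = 1.
  have [|x <- xN] := hom_max_value (y := y) Iq'.
    apply/eqP; rewrite eq_le.
    rewrite (cmod_le_sup_norm Y_nonempty Y_compact UB)/=; last first.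
      exact/inv_ua/hom_inv.
    by rewrite hom_norm// aE (sup_norm_le X_nonempty X_compact UA)//; exact: inv_ua.
  apply: q'1E; apply/eqP; rewrite eq_le q'1/=.
  rewrite xN -(hom_norm Iq') -aE (cmod_le_sup_norm Y_nonempty Y_compact UB)//.
  exact/inv_ua/hom_inv.
exists y; first exact: Tg1.
have Tq'f : T (q' * f) y = T f y.
  by rewrite homM// (_ : (T q' * T f) y = T q' y * T f y)// Tq'y mul1r.
have fy : M <= cmod (T f y).
  by move: My; rewrite aE bE !mulr1 Tp1 !cmodM aE bE mul1r mulr1.
have [|x fx xN] := hom_max_value (y := y) I'f.
  apply/eqP; rewrite eq_le (cmod_le_sup_norm Y_nonempty Y_compact UB)/=; last first.
    exact/inv_ua/hom_inv.
  rewrite hom_norm// Tq'f (le_trans _ fy)//.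
  by rewrite (sup_norm_le X_nonempty X_compact UA (inv_ua I'f)).
have qx : q x = 1.
  apply: contrapT => /(hq' x).2; apply/negP; rewrite -leNgt.
  rewrite -[q' x * f x]/((q' * f) x) fx Tq'f; exact: fy.
by rewrite -Tq'f -fx (_ : (q' * f) x = q' x * f x)// (hq' x).1// mul1r fz.
Qed.

(** Were the defect [d] nonzero, a peak set inside [{d = d y0}], with [d y0] of
    largest modulus, would carry constant values of [T f1], [T f2] and
    [T (f1 + f2)]; transport identifies these with constant values of [f1], [f2]
    and [f1 + f2], so that [d] would vanish there. *)
Lemma homD f1 f2 : invertibles A f1 -> invertibles A f2 ->
  invertibles A (f1 + f2) -> T (f1 + f2) = T f1 + T f2.
Proof.
move=> I1 I2 I3.
pose d : Y -> R[i]^o := T (f1 + f2) - T f1 - T f2.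
have dE y : d y = T (f1 + f2) y - T f1 y - T f2 y by [].
have [b1 b2 b3] : [/\ B (T f1), B (T f2) & B (T (f1 + f2))].
  by split; exact/inv_ua/hom_inv.
have Bd : B d by apply: (ua_sub UB) => //; exact: ua_sub.
have [y0 y0N] := sup_norm_attained Y_nonempty Y_compact UB Bd.
have dmax y : cmod (d y) <= cmod (d y0).
  by rewrite y0N (cmod_le_sup_norm Y_nonempty Y_compact UB).
have [d0|d0] := eqVneq (d y0) 0.
  apply/funext => y; apply/eqP; rewrite -subr_eq0 -cmod_eq0.
  have := dmax y; rewrite d0 cmod0 dE => h.
  by rewrite eq_le cmod_ge0 andbT opprD addrA.
exfalso.
have [k0 pk0 k0d] := peak_at_max Y_nonempty Y_compact UB Bd d0 dmax.
have [k1 [w1 [pk1 k10 k1w]]] :=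
  constant_peak Y_nonempty Y_compact UB pk0 b1.
have [k2 [w2 [pk2 k21 k2w]]] :=
  constant_peak Y_nonempty Y_compact UB pk1 b2.
have [k [w3 [pk kk2 kw]]] :=
  constant_peak Y_nonempty Y_compact UB pk2 b3.
have [Ik k1' _ [y1 ky1]] := pk.
have [g Ig Tgk] := hom_onto Ik.
have Ng : sup_norm g = 1.
  rewrite -hom_norm// Tgk; apply/eqP; rewrite eq_le.
  rewrite (sup_norm_le Y_nonempty Y_compact UB (inv_ua Ik))//=.
  rewrite -cmod1 -ky1 (cmod_le_sup_norm Y_nonempty Y_compact UB)//; exact: inv_ua.
have [x0 gx0] := sup_norm_attained X_nonempty X_compact UA (inv_ua Ig).
have gmax x : cmod (g x) <= cmod (g x0).
  by rewrite gx0 (cmod_le_sup_norm X_nonempty X_compact UA)//; exact: inv_ua.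
have [q0 pq0 q0g] :=
  peak_at_max X_nonempty X_compact UA (inv_ua Ig) (inv_neq0 x0 Ig) gmax.
have [q1 [z1 [pq1 q10 q1z]]] :=
  constant_peak X_nonempty X_compact UA pq0 (inv_ua I1).
have [q [z2 [pq qq1 qz]]] :=
  constant_peak X_nonempty X_compact UA pq1 (inv_ua I2).
have tr f z : invertibles A f -> (forall x, q x = 1 -> f x = z) ->
    exists2 y, k y = 1 & T f y = z.
  move=> If fz; rewrite -Tgk; apply: (peak_value_transport If Ig _ _ pq) => //.
  - by rewrite Tgk.
  - by move=> x; rewrite -Ng -gx0 gmax.
  - by move=> x /qq1/q10/q0g ->; rewrite gx0.
have [u1 ku1 Tu1] := tr _ _ I1 (fun x qx => q1z x (qq1 x qx)).
have [u2 ku2 Tu2] := tr _ _ I2 qz.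
have [u3 ku3 Tu3] : exists2 y, k y = 1 & T (f1 + f2) y = z1 + z2.
  by apply: tr => // x qx; rewrite -(qz x qx) -(q1z x (qq1 x qx)).
move/eqP: d0; apply; rewrite -((k0d y1).1 (k10 _ (k21 _ (kk2 _ ky1)))) dE.
rewrite (kw y1 ky1) -(kw u3 ku3) Tu3.
rewrite (k2w y1 (kk2 _ ky1)) -(k2w u2 (kk2 _ ku2)) Tu2.
rewrite (k1w y1 (k21 _ (kk2 _ ky1))) -(k1w u1 (k21 _ (kk2 _ ku1))) Tu1.
by ring.
Qed.

(** * Extension to the whole algebra *)

(** For the homomorphisms at hand every constant larger than the sup norm of [f]
    gives the same value; taking a definite one makes this a function. *)
Definition shift_extension f : Y -> R[i]^o :=
  T (f + cst (sup_norm f + 1)%:C%C) - cst (sup_norm f + 1)%:C%C.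

Local Notation S := shift_extension.

Lemma inv_shift f (r : R) : A f -> sup_norm f < r ->
  [/\ invertibles A (f + cst r%:C%C), invertibles A (cst r%:C%C) &
      T (cst r%:C%C) = cst r%:C%C].
Proof.
move=> Af fr.
have r0 : 0 < r.
  by rewrite (le_lt_trans _ fr)// (sup_norm_ge0 X_nonempty X_compact UA).
have c0 : (r%:C%C : R[i]) != 0 by rewrite -cmod_gt0 cmod_real// ltW.
split; [|exact: invertible_cst|exact: hom_cst].
by apply: (invertible_shift X_nonempty X_compact UA) => //; rewrite cmod_real// ltW.
Qed.

(** Shifting by an arbitrary invertible [u] is as good as shifting by the
    constant in the definition of [S]: compare both with a constant [c] so large
    that [f + c], [f + c + u] and the like are invertible, and apply additivity
    to the two splittings [(f + c) + u] and [(f + u) + c]. *)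
Lemma extension_add_inv f u : A f -> invertibles A u -> invertibles A (f + u) ->
  S f + T u = T (f + u).
Proof.
move=> Af Iu Ifu; pose s := sup_norm f + 1; pose r := sup_norm f + sup_norm u + 1.
have Au := inv_ua Iu.
have u0 := sup_norm_ge0 X_nonempty X_compact UA Au.
have f0 := sup_norm_ge0 X_nonempty X_compact UA Af.
have [Is Ics Ts] : [/\ invertibles A (f + cst s%:C%C), invertibles A (cst s%:C%C) &
    T (cst s%:C%C) = cst s%:C%C] by apply: inv_shift => //; rewrite /s; lra.
have rfu : sup_norm (f + u) < r.
  rewrite (le_lt_trans (sup_normD X_nonempty X_compact UA Af Au))// /r; lra.
have [Ir Icr Tr] : [/\ invertibles A (f + cst r%:C%C), invertibles A (cst r%:C%C) &
    T (cst r%:C%C) = cst r%:C%C] by apply: inv_shift => //; rewrite /r; lra.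
have [Ifur _ _] := inv_shift (ua_add UA Af Au) rfu.
have crs : cst r%:C%C + cst s%:C%C = cst (r + s)%:C%C :> (X -> R[i]^o).
  by apply/funext => x; rewrite [RHS](rmorphD (real_complex R) r s).
have rs : sup_norm f < r + s by rewrite /r /s; lra.
have [Irs _ _] := inv_shift Af rs.
have e1 : T (f + cst r%:C%C) + cst s%:C%C = T (f + cst s%:C%C) + cst r%:C%C.
  rewrite -[X in _ + X = _]Ts -[X in _ = _ + X]Tr -!homD//.
  - by rewrite addrAC.
  - by rewrite -addrA [cst s%:C%C + _]addrC crs.
  - by rewrite -addrA crs.
have e2 : T (f + cst r%:C%C) + T u = T (f + u) + cst r%:C%C.
  rewrite -[X in _ = _ + X]Tr -!homD//; first by rewrite addrAC.
  by rewrite addrAC.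
rewrite /shift_extension -/s.
apply: (addIr (cst r%:C%C)); rewrite -e2 addrAC; congr (_ + _).
by rewrite addrAC -e1 addrK.
Qed.

Lemma extension_shift f (r : R) : A f -> sup_norm f < r ->
  T (f + cst r%:C%C) = S f + cst r%:C%C.
Proof.
by move=> Af fr; have [I1 I2 e] := inv_shift Af fr; rewrite -extension_add_inv// e.
Qed.

Lemma extension_inv f : invertibles A f -> S f = T f.
Proof.
move=> If; have Af := inv_ua If.
have f1 : sup_norm f < sup_norm f + 1 by rewrite ltrDl.
have [I1 I2 e] := inv_shift Af f1.
by rewrite /shift_extension homD// e addrK.
Qed.

Lemma extension_in f : A f -> B (S f).
Proof.
move=> Af; have f1 : sup_norm f < sup_norm f + 1 by rewrite ltrDl.
have [I1 _ _] := inv_shift Af f1.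
by apply: (ua_sub UB); [exact/inv_ua/hom_inv|exact: ua_cst].
Qed.

Lemma extensionD f g : A f -> A g -> S (f + g) = S f + S g.
Proof.
move=> Af Ag; pose r := sup_norm f + sup_norm g + 1.
have g0 := sup_norm_ge0 X_nonempty X_compact UA Ag.
have f0 := sup_norm_ge0 X_nonempty X_compact UA Af.
have fr : sup_norm f < r by rewrite /r; lra.
have gr : sup_norm g < r by rewrite /r; lra.
have fgr : sup_norm (f + g) < r.
  by rewrite (le_lt_trans (sup_normD X_nonempty X_compact UA Af Ag))// /r; lra.
have [Ifg _ _] := inv_shift (ua_add UA Af Ag) fgr.
have [If Ic Tc] := inv_shift Af fr.
have e := extension_shift (ua_add UA Af Ag) fgr.
have := extension_add_inv Ag If; rewrite extension_shift// addrCA addrA => /(_ Ifg).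
by rewrite e addrA [S g + _]addrC => /addIr.
Qed.

(** Multiplicativity of [T] on [(f + c) (g + c)], expanded by additivity; the mixed
    terms need [S (c h) = c (S h)] for the constant [c], which comes from
    shifting [c h] by [c s] with [s] a large constant. *)
Lemma extensionM f g : A f -> A g -> S (f * g) = S f * S g.
Proof.
move=> Af Ag; pose r := sup_norm f + sup_norm g + 1.
have g0 := sup_norm_ge0 X_nonempty X_compact UA Ag.
have f0 := sup_norm_ge0 X_nonempty X_compact UA Af.
have fr : sup_norm f < r by rewrite /r; lra.
have gr : sup_norm g < r by rewrite /r; lra.
have [If Ic Tc] := inv_shift Af fr.
have [Ig _ _] := inv_shift Ag gr.
have Scst h : A h -> S (cst r%:C%C * h) = cst r%:C%C * S h.
  move=> Ah.
  have hs : sup_norm h < sup_norm h + 1 by rewrite ltrDl.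
  set s := sup_norm h + 1 in hs.
  have [Ihs Ics Tcs] := inv_shift Ah hs.
  apply: (addIr (T (cst r%:C%C * cst s%:C%C))).
  rewrite extension_add_inv//; last first.
  - by rewrite -mulrDr; exact: invertible_mul.
  - exact: invertible_mul.
  - by apply: ua_mul => //; exact: inv_ua.
  by rewrite -mulrDr !homM// Tc Tcs extension_shift// mulrDr.
have Ac := inv_ua Ic.
have Acc : A (cst r%:C%C * cst r%:C%C) by exact: ua_mul.
have e1 : T ((f + cst r%:C%C) * (g + cst r%:C%C)) =
    (S f + cst r%:C%C) * (S g + cst r%:C%C) by rewrite homM// !extension_shift.
have I2 : invertibles A ((f + cst r%:C%C) * (g + cst r%:C%C)).
  exact: invertible_mul.
have expand (V : comPzRingType) (a b c : V) :
  (a + c) * (b + c) = a * b + c * a + (c * b + c * c) by ring.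
move: e1; rewrite -extension_inv// !expand.
have Acf : A (cst r%:C%C * f) by exact: ua_mul.
have Acg : A (cst r%:C%C * g) by exact: ua_mul.
have Afg : A (f * g) by exact: ua_mul.
rewrite (extensionD (ua_add UA Afg Acf) (ua_add UA Acg Acc)).
rewrite (extensionD Afg Acf) (extensionD Acg Acc) !Scst// (extension_inv Ic) Tc.
by move=> /addIr/addIr.
Qed.

Lemma extension_scale (c : R[i]) f : A f -> S (c *: f) = c *: S f.
Proof.
move=> Af; have cM (Z : Type) (h : Z -> R[i]^o) : c *: h = cst c * h by [].
rewrite !cM extensionM//; last exact: ua_cst.
have [->|c0] := eqVneq c 0; last first.
  by rewrite (extension_inv (invertible_cst UA c0)) hom_cst.
have -> : S (cst 0) = cst 0; last by [].
have e := @extensionD 0 0 (ua_cst UA 0) (ua_cst UA 0).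
by move: e; rewrite addr0 => /esym/eqP; rewrite -subr_eq0 addrK => /eqP.
Qed.

Lemma extensionB f g : A f -> A g -> S (f - g) = S f - S g.
Proof.
move=> Af Ag; rewrite -scaleN1r extensionD//; last exact: ua_scale.
by rewrite extension_scale// scaleN1r.
Qed.

(** The norms of [f] and [S f] are both read off from those of the invertible
    functions [f + w] and [T (f + w) = S f + w], with [w] pointing in the
    direction of a value of largest modulus. *)
Lemma extension_norm f : A f -> sup_norm (S f) = sup_norm f.
Proof.
move=> Af; have BS := extension_in Af.
have shift w : sup_norm f < cmod w -> sup_norm (f + cst w) = sup_norm (S f + cst w).
  move=> fw; have w0 : w != 0.
    rewrite -cmod_gt0 (le_lt_trans _ fw)//.
    exact: (sup_norm_ge0 X_nonempty X_compact UA).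
  have If := invertible_shift X_nonempty X_compact UA Af fw.
  rewrite -(hom_norm If) -extension_add_inv//; last exact: invertible_cst.
  by rewrite hom_cst.
apply/eqP; rewrite eq_le; apply/andP; split.
  have [y yN] := sup_norm_attained Y_nonempty Y_compact UB BS.
  rewrite leNgt -yN; apply/negP => lt; set w := S f y in lt.
  have lo : 2 * cmod w <= sup_norm (S f + cst w).
    apply: le_trans (cmod_le_sup_norm Y_nonempty Y_compact UB y _).
      rewrite (_ : (S f + cst w) y = 2%:R * w) ?cmodM ?cmod_nat//.
      by rewrite mulr_natl mulr2n.
    by apply: ua_add => //; exact: ua_cst.
  have : sup_norm (f + cst w) <= sup_norm f + cmod w.
    apply: (sup_norm_le X_nonempty X_compact UA).
      by apply: ua_add => //; exact: ua_cst.
    move=> x; apply: le_trans (cmodD _ _) _.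
    by rewrite lerD2r (cmod_le_sup_norm X_nonempty X_compact UA).
  by rewrite shift//; lra.
have [x xN] := sup_norm_attained X_nonempty X_compact UA Af.
have [fx0|fx0] := eqVneq (f x) 0.
  by rewrite -xN fx0 cmod0 (sup_norm_ge0 Y_nonempty Y_compact UB).
have fx0' : 0 < cmod (f x) by rewrite cmod_gt0.
pose w : R[i] := 2%:R * f x.
have wE : cmod w = 2 * cmod (f x) by rewrite cmodM cmod_nat.
have fw : sup_norm f < cmod w by rewrite wE -xN; lra.
have lo : 3 * cmod (f x) <= sup_norm (f + cst w).
  apply: le_trans (cmod_le_sup_norm X_nonempty X_compact UA x _).
    rewrite (_ : (f + cst w) x = 3%:R * f x) ?cmodM ?cmod_nat//.
    by rewrite [LHS](_ : _ = f x + 2%:R * f x)//; ring.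
  by apply: ua_add => //; exact: ua_cst.
have : sup_norm (S f + cst w) <= sup_norm (S f) + cmod w.
  apply: (sup_norm_le Y_nonempty Y_compact UB).
    by apply: ua_add => //; exact: ua_cst.
  move=> y; apply: le_trans (cmodD _ _) _.
  by rewrite lerD2r (cmod_le_sup_norm Y_nonempty Y_compact UB).
by rewrite -shift// wE -xN; lra.
Qed.

Lemma extension_inj f g : A f -> A g -> S f = S g -> f = g.
Proof.
move=> Af Ag e; apply/funext => x; apply/eqP; rewrite -subr_eq0 -cmod_eq0.
have Afg := ua_sub UA Af Ag.
rewrite eq_le cmod_ge0 andbT.
apply: le_trans (cmod_le_sup_norm X_nonempty X_compact UA x Afg) _.
rewrite -extension_norm// extensionB// e subrr.
by apply: (sup_norm_le Y_nonempty Y_compact UB (ua_cst UB 0)) => y; rewrite cmod0.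
Qed.

Lemma extension_onto k : B k -> exists2 f, A f & S f = k.
Proof.
move=> Bk; pose r := sup_norm k + 1.
have k0 := sup_norm_ge0 Y_nonempty Y_compact UB Bk.
have r0 : 0 < r by rewrite /r; lra.
have c0 : (r%:C%C : R[i]) != 0 by rewrite -cmod_gt0 cmod_real// ltW.
have Ik : invertibles B (k + cst r%:C%C).
  apply: (invertible_shift Y_nonempty Y_compact UB) => //.
  by rewrite cmod_real ?ltrDl// ltW.
have [g Ig Tg] := hom_onto Ik.
have Ic := invertible_cst UA c0.
exists (g - cst r%:C%C); first by apply: (ua_sub UA); exact: inv_ua.
rewrite extensionB; [|exact: inv_ua..].
by rewrite !extension_inv// Tg hom_cst// addrK.
Qed.

Lemma shift_extension_isomorphism : isometric_algebra_isomorphism A B S.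
Proof.
split.
- split.
  + by move=> f Af; exact: extension_in.
  + by move=> f g /set_mem Af /set_mem Ag; exact: (extension_inj Af Ag).
  + by move=> k Bk; have [f Af <-] := extension_onto Bk; exists f.
- exact: extensionD.
- exact: extension_scale.
- exact: extensionM.
- move=> f g Af Ag; rewrite -extensionB//.
  by apply: extension_norm; exact: ua_sub.
Qed.

End PeripheralHomomorphism.

Theorem corollary4p2 (R : realType) (X Y : topologicalType)
    (X_nonempty : [set: X] !=set0) (Y_nonempty : [set: Y] !=set0)
    (X_compact : compact [set: X]) (Y_compact : compact [set: Y])
    (X_hausdorff : hausdorff_space X) (Y_hausdorff : hausdorff_space Y)
    (A : set (X -> R[i]^o)) (B : set (Y -> R[i]^o))
    (A_uniform : uniform_algebra A) (B_uniform : uniform_algebra B)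
    (T : (X -> R[i]^o) -> (Y -> R[i]^o))
    (T_hom : group_hom_onto A B T)
    (T_spec : forall f, invertibles A f ->
       peripheral_spectrum B (T f) `<=` peripheral_spectrum A f) :
  exists S : (X -> R[i]^o) -> (Y -> R[i]^o),
    isometric_algebra_isomorphism A B S /\
    (forall f, invertibles A f -> S f = T f).
Proof.
exists (@shift_extension R X Y T); split.
  exact: (shift_extension_isomorphism X_nonempty Y_nonempty X_compact Y_compact
    A_uniform B_uniform T_hom T_spec).
move=> f; exact: (extension_inv X_nonempty Y_nonempty X_compact Y_compact
  A_uniform B_uniform T_hom T_spec).
Qed.
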